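(* Every unital QT operator algebra has a tracial state.
   Context: An operator algebra is a norm-closed (not necessarily selfadjoint) subalgebra of $\mathbb B(H)$ for some Hilbert space $H$, with the induced matrix norms. An operator algebra $A$ is quasitriangular (QT) if there is a net of completely contractive maps $\phi_i:A\to\mathbb M_{k_i}(\mathbb C)$ with $\lim_i\|\phi_i(a)\|=\|a\|$ and $\lim_i\|\phi_i(ab)-\phi_i(a)\phi_i(b)\|=0$ for all $a,b\in A$. A state $\tau$ on a unital operator algebra $A$ is a linear functional with $\tau(1)=\|\tau\|=1$; it is a tracial state if moreover $\tau(ab)=\tau(ba)$ for all $a,b\in A$. *)

(* Defs.v *)
From HB Require Import structures.
From mathcomp Require Import all_boot all_order all_algebra.
From mathcomp Require Import sesquilinear complex.
From mathcomp Require Import all_classical all_reals all_analysis.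

Set Implicit Arguments.
Unset Strict Implicit.
Unset Printing Implicit Defensive.

Import Order.TTheory GRing.Theory Num.Theory.
Import numFieldNormedType.Exports.

Local Open Scope classical_set_scope.
Local Open Scope complex_scope.
Local Open Scope ring_scope.

(* The norm of a normed space over R[i] takes its values in R[i], on the
   nonnegative real half-line; [rnorm] is the same norm with values in R. *)
Definition rnorm (R : realType) (V : normedZmodType R[i]) (x : V) : R :=
  complex.Re `|x|.

(* The norm of the l2-direct sum of n copies of a space V with norm N. *)
Definition l2norm (R : realType) (V : Type) (N : V -> R) (n : nat)
    (x : 'I_n -> V) : R :=
  Num.sqrt (\sum_(i < n) N (x i) ^+ 2).

(* The Euclidean norm on C^k (the library norm on matrices is the max norm). *)
Definition cvnorm (R : realType) (k : nat) (v : 'cV[R[i]]_k) : R :=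
  l2norm (@rnorm R R[i]) (fun i => v i 0).

(* The suprema below are taken in R, where the supremum of a set without an
   upper bound is 0; [opnorm] and [mxopnorm] are only meant for (matrices of)
   bounded operators, for which the sets are bounded. *)
Definition opnorm (R : realType) (V : Type) (N : V -> R) (a : V -> V) : R :=
  sup [set N (a x) | x in [set x | N x <= 1]].

(* The norm of M_n(B(V)) = B(V^n): a matrix of operators acts on the l2-sum
   V^n by the usual matrix-vector rule. *)
Definition mxopnorm (R : realType) (V : nmodType) (N : V -> R) (n : nat)
    (a : 'M[V -> V]_n) : R :=
  sup [set l2norm N (fun i => \sum_(j < n) a i j (x j))
      | x in [set x : 'I_n -> V | l2norm N x <= 1]].

(* M_k(C) = B(C^k), with its operator norm and its matrix norms. *)
Definition Mnorm (R : realType) (k : nat) (M : 'M[R[i]]_k) : R :=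
  opnorm (@cvnorm R k) (fun v : 'cV[R[i]]_k => M *m v).

Definition mxMnorm (R : realType) (k n : nat) (M : 'M['M[R[i]]_k]_n) : R :=
  mxopnorm (@cvnorm R k)
    (map_mx (fun (B : 'M[R[i]]_k) (v : 'cV[R[i]]_k) => B *m v) M).

(* [dot] makes the Banach space H a Hilbert space. *)
Definition hilbert_dot (R : realType) (H : completeNormedModType R[i])
    (dot : {dot H for (@Num.conj R[i])}) : Prop :=
  forall x : H, dot x x = `|x| ^+ 2.

(* The set B(H). *)
Definition bounded_op (R : realType) (H : normedModType R[i]) :
    set (H -> H) :=
  [set a | linear a /\ exists M : R, forall x, rnorm (a x) <= M * rnorm x].

Record operator_algebra (R : realType) (H : normedModType R[i])
    (A : set (H -> H)) : Prop := {
  opalg_bounded : A `<=` @bounded_op R H ;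
  opalg_zero : A 0 ;
  opalg_lin : forall (c : R[i]) a b, A a -> A b -> A (c *: a + b) ;
  opalg_mul : forall a b, A a -> A b -> A (a \o b) ;
  opalg_closed : forall a, bounded_op a ->
    (forall eps : R, 0 < eps ->
      exists2 b, A b & opnorm (@rnorm R H) (a - b) < eps) -> A a
}.

(* The unit is not assumed to be the identity operator of H; it has norm 1,
   so that in particular A is not the zero algebra. *)
Record opalg_unit (R : realType) (H : normedModType R[i])
    (A : set (H -> H)) (e : H -> H) : Prop := {
  unit_in : A e ;
  unit_mull : forall a, A a -> e \o a = a ;
  unit_mulr : forall a, A a -> a \o e = a ;
  unit_norm : opnorm (@rnorm R H) e = 1
}.

(* Maps defined on A are represented by functions on all of H -> H whose
   values outside A are irrelevant. *)
Definition linear_on (R : realType) (H : normedModType R[i])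
    (A : set (H -> H)) (W : lmodType R[i]) (f : (H -> H) -> W) : Prop :=
  forall (c : R[i]) a b, A a -> A b -> f (c *: a + b) = c *: f a + f b.

Definition completely_contractive (R : realType) (H : normedModType R[i])
    (A : set (H -> H)) (k : nat) (phi : (H -> H) -> 'M[R[i]]_k) : Prop :=
  linear_on A phi /\
  forall (n : nat) (a : 'M[H -> H]_n), (forall i j, A (a i j)) ->
    mxMnorm (map_mx phi a) <= mxopnorm (@rnorm R H) a.

Record directed (I : Type) (le : I -> I -> Prop) : Prop := {
  dir_inhabited : inhabited I ;
  dir_refl : forall i, le i i ;
  dir_trans : forall i j l, le i j -> le j l -> le i l ;
  dir_ub : forall i j, exists l, le i l /\ le j l
}.

Definition tails (I : Type) (le : I -> I -> Prop) : set_system I :=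
  filter_from [set: I] (fun i => [set j | le i j]).

Definition quasitriangular (R : realType) (H : normedModType R[i])
    (A : set (H -> H)) : Prop :=
  exists (I : Type) (le : I -> I -> Prop) (k : I -> nat)
         (phi : forall i : I, (H -> H) -> 'M[R[i]]_(k i)),
    [/\ directed le,
        forall i, (0 < k i)%N,
        forall i, completely_contractive A (phi i),
        forall a, A a ->
          (fun i => Mnorm (phi i a)) @ tails le --> opnorm (@rnorm R H) a
      & forall a b, A a -> A b ->
          (fun i => Mnorm (phi i (a \o b) - phi i a *m phi i b))
            @ tails le --> (0 : R)].

(* The supremum 1 forces the set to be bounded, see above. *)
Definition state (R : realType) (H : normedModType R[i])
    (A : set (H -> H)) (e : H -> H) (tau : (H -> H) -> R[i]) : Prop :=
  [/\ linear_on A (tau : (H -> H) -> R[i]^o),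
      tau e = 1
    & sup [set rnorm (tau a)
          | a in [set a | A a /\ opnorm (@rnorm R H) a <= 1]] = 1].

Definition tracial_state (R : realType) (H : normedModType R[i])
    (A : set (H -> H)) (e : H -> H) (tau : (H -> H) -> R[i]) : Prop :=
  state A e tau /\ forall a b, A a -> A b -> tau (a \o b) = tau (b \o a).

(* Main.v *)
(* Write E for the image of the unit under one of the maps phi_i, an almost
   idempotent matrix.  In an orthonormal basis that diagonalizes E^* E the
   columns of E are orthogonal, and testing E - E^2 against E^* shows that each
   column j of E has small norm unless the entry E_jj is close to 1.  The
   normalized trace t of the corner spanned by the basis vectors of the second
   kind is contractive and almost 1 at E; the normalized trace of the whole
   matrix algebra would not do, since the corner may have small relative
   dimension.  If X is close to X E and Y to Y E, then t(XY) is close to t(YX),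
   because the part of the product X Y that leaves the corner goes through the
   restriction of E to the orthogonal complement of the corner.  An ultrafilter
   limit of the functionals a |-> t_i(phi_i(a)) is then a tracial state, the
   convergence of the norms of phi_i(a) bounding it by the norm of a. *)

Require Import Defs.
From mathcomp Require Import all_boot all_order all_algebra.
From mathcomp Require Import sesquilinear spectral complex.
From mathcomp Require Import all_classical all_reals all_analysis.
From mathcomp Require Import ring lra.

Set Implicit Arguments.
Unset Strict Implicit.
Unset Printing Implicit Defensive.

Import Order.TTheory GRing.Theory Num.Theory.
Import numFieldNormedType.Exports.

Local Open Scope classical_set_scope.
Local Open Scope complex_scope.
Local Open Scope sesquilinear_scope.
Local Open Scope ring_scope.

(** * The Euclidean norm on C^k and the operator norm of matrices *)

Lemma CauchySchwarz_adj (C : numClosedFieldType) k (u v : 'cV[C]_k) :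
  `|(u^t* *m v) 0 0| ^+ 2 <= (u^t* *m u) 0 0 * (v^t* *m v) 0 0.
Proof.
have dotE (w w' : 'cV[C]_k) : (w^t* *m w') 0 0 = dotmx (w^t*) (w'^t*).
  by rewrite dotmxE trmxCK.
by rewrite !dotE; have [] := CauchySchwarz (@dotmx C k) (u^t* ) (v^t* ).
Qed.

Section Norms.
Variable R : realType.
Implicit Types (z : R[i]) (k : nat).

Lemma realC_inj (x y : R) : x%:C = y%:C -> x = y.
Proof. by case. Qed.

Lemma rnormE z : (rnorm z)%:C = `|z|.
Proof. by rewrite /rnorm RRe_real // normr_real. Qed.

Lemma rnorm_ge0 (V : normedZmodType R[i]) (x : V) : 0 <= rnorm x.
Proof. by have := normr_ge0 x; rewrite lecE => /andP[]. Qed.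

Lemma rnormM z1 z2 : rnorm (z1 * z2) = rnorm z1 * rnorm z2.
Proof. by apply: realC_inj; rewrite rmorphM /= !rnormE normrM. Qed.

Lemma rnormD z1 z2 : rnorm (z1 + z2) <= rnorm z1 + rnorm z2.
Proof. by rewrite -lecR rmorphD /= !rnormE ler_normD. Qed.

Lemma rnormN z : rnorm (- z) = rnorm z.
Proof. by rewrite /rnorm normrN. Qed.

Lemma rnorm0 : rnorm (0 : R[i]) = 0.
Proof. by rewrite /rnorm normr0. Qed.

Lemma rnorm1 : rnorm (1 : R[i]) = 1.
Proof. by rewrite /rnorm normr1. Qed.

Lemma rnormC (x : R) : 0 <= x -> rnorm x%:C = x.
Proof. by move=> x0; apply: realC_inj; rewrite rnormE ger0_norm // ler0c. Qed.

Lemma rnormCK z : (rnorm z ^+ 2)%:C = z * z^*%R.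
Proof. by rewrite rmorphXn /= rnormE normCK. Qed.

Lemma rnorm_sum (I : finType) (P : pred I) (F : I -> R[i]) :
  rnorm (\sum_(i | P i) F i) <= \sum_(i | P i) rnorm (F i).
Proof.
rewrite -lecR rmorph_sum /= rnormE.
by under [leRHS]eq_bigr do rewrite rnormE; exact: ler_norm_sum.
Qed.

Lemma cvnorm_ge0 k (v : 'cV[R[i]]_k) : 0 <= cvnorm v.
Proof. exact: sqrtr_ge0. Qed.

Lemma cvnorm_sqr k (v : 'cV[R[i]]_k) :
  cvnorm v ^+ 2 = \sum_(i < k) rnorm (v i 0) ^+ 2.
Proof. by rewrite sqr_sqrtr // sumr_ge0 // => i _; rewrite sqr_ge0. Qed.

Lemma cvnorm_adj k (v : 'cV[R[i]]_k) : (cvnorm v ^+ 2)%:C = (v^t* *m v) 0 0.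
Proof.
rewrite cvnorm_sqr rmorph_sum mxE; apply: eq_bigr => i _ /=.
by rewrite rnormCK !mxE mulrC.
Qed.

Lemma cvnorm_gram_eq k m (v : 'cV[R[i]]_k) (w : 'cV[R[i]]_m) :
  (v^t* *m v) 0 0 = (w^t* *m w) 0 0 -> cvnorm v = cvnorm w.
Proof.
rewrite -!cvnorm_adj => /realC_inj/eqP.
by rewrite eqrXn2 ?cvnorm_ge0 // => /eqP.
Qed.

Lemma cvnorm_coord k (v : 'cV[R[i]]_k) i : rnorm (v i 0) <= cvnorm v.
Proof.
rewrite -(@ler_pXn2r _ 2) ?nnegrE ?rnorm_ge0 ?cvnorm_ge0 // cvnorm_sqr.
by rewrite (bigD1 i) //= lerDl sumr_ge0 // => j _; rewrite sqr_ge0.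
Qed.

Lemma cvnorm_delta k (j : 'I_k) : cvnorm (delta_mx j 0 : 'cV[R[i]]_k) = 1.
Proof.
rewrite /cvnorm /l2norm (bigD1 j) //= big1 => [|i /negPf ij].
  by rewrite mxE !eqxx rnorm1 addr0 expr1n sqrtr1.
by rewrite mxE ij /= rnorm0 expr0n.
Qed.

Lemma cvnormZ k (c : R) (v : 'cV[R[i]]_k) : 0 <= c ->
  cvnorm (c%:C *: v) = c * cvnorm v.
Proof.
move=> c0; apply/eqP; rewrite -(@eqrXn2 _ 2) ?mulr_ge0 ?cvnorm_ge0 //.
rewrite exprMn !cvnorm_sqr mulr_sumr; apply/eqP/eq_bigr => i _.
by rewrite mxE rnormM rnormC // exprMn.
Qed.

Lemma cvnorm_CauchySchwarz k (u v : 'cV[R[i]]_k) :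
  rnorm ((u^t* *m v) 0 0) <= cvnorm u * cvnorm v.
Proof.
rewrite -(@ler_pXn2r _ 2) ?nnegrE ?rnorm_ge0 ?mulr_ge0 ?cvnorm_ge0 //.
rewrite exprMn -lecR [leRHS]rmorphM [leLHS]rmorphXn /= rnormE !cvnorm_adj.
exact: CauchySchwarz_adj.
Qed.

(** Explicit bounds avoid checking at every step that the supremum in [Mnorm] is taken over a
    bounded set; [bounded_by_Mnorm] and [Mnorm_le] translate between the two. *)
Definition bounded_by k (c : R) (M : 'M[R[i]]_k) : Prop :=
  forall v, cvnorm (M *m v) <= c * cvnorm v.

Lemma bounded_by_mul k (M N : 'M[R[i]]_k) c d : 0 <= c ->
  bounded_by c M -> bounded_by d N -> bounded_by (c * d) (M *m N).
Proof.
move=> c0 Mc Nd v; rewrite -mulmxA; apply: le_trans (Mc _) _.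
by rewrite -mulrA ler_wpM2l.
Qed.

Lemma bounded_by_entry k (M : 'M[R[i]]_k) c i j :
  bounded_by c M -> rnorm (M i j) <= c.
Proof.
move=> /(_ (delta_mx j 0)); rewrite cvnorm_delta mulr1 -colE.
by apply: le_trans; have := cvnorm_coord (col j M) i; rewrite mxE.
Qed.

(** Cauchy-Schwarz applied to each row: the Hilbert-Schmidt norm of [M] is a bound. *)
Lemma bounded_by_exists k (M : 'M[R[i]]_k) : exists c, bounded_by c M.
Proof.
pose r i := cvnorm ((row i M)^t*).
exists (Num.sqrt (\sum_i r i ^+ 2)) => v.
have r0 : 0 <= \sum_i r i ^+ 2 by rewrite sumr_ge0 // => i _; rewrite sqr_ge0.
rewrite -(@ler_pXn2r _ 2) ?nnegrE ?mulr_ge0 ?sqrtr_ge0 ?cvnorm_ge0 //.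
rewrite exprMn cvnorm_sqr (sqr_sqrtr r0) mulr_suml ler_sum // => i _.
rewrite -exprMn ler_pXn2r ?nnegrE ?rnorm_ge0 ?mulr_ge0 ?cvnorm_ge0 //.
suff -> : (M *m v) i 0 = ((row i M)^t*^t* *m v) 0 0 by exact: cvnorm_CauchySchwarz.
by rewrite trmxCK !mxE; apply: eq_bigr => j _; rewrite mxE.
Qed.

Lemma cvnorm0 k : cvnorm (0 : 'cV[R[i]]_k) = 0.
Proof.
by rewrite /cvnorm /l2norm big1 ?sqrtr0 // => i _; rewrite mxE rnorm0 expr0n.
Qed.

Lemma cvnorm0_eq0 k (v : 'cV[R[i]]_k) : cvnorm v = 0 -> v = 0.
Proof.
move=> v0; apply/colP => i; rewrite mxE; apply/eqP.
rewrite -normr_eq0 -rnormE.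
have := cvnorm_coord v i; rewrite v0 => vi.
by rewrite (@le_anti _ _ (rnorm (v i 0)) 0) // vi rnorm_ge0.
Qed.

(** Rescaling [v] to norm 1 puts it into the unit ball of the supremum; [bounded_by_exists] ensures
    that this supremum is a genuine one. *)
Lemma bounded_by_Mnorm k (M : 'M[R[i]]_k) : bounded_by (Mnorm M) M.
Proof.
move=> v; have [/cvnorm0_eq0 ->|v0] := eqVneq (cvnorm v) 0.
  by rewrite mulmx0 cvnorm0 mulr0.
have vgt0 : 0 < cvnorm v by rewrite lt_def v0 cvnorm_ge0.
have [c Mc] := bounded_by_exists M.
rewrite mulrC -ler_pdivrMl // -cvnormZ ?invr_ge0 ?cvnorm_ge0 //.
rewrite scalemxAr; apply: ub_le_sup.
  exists c => _ [w /= w1 <-].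
  have c0 : 0 <= c * cvnorm v := le_trans (cvnorm_ge0 _) (Mc v).
  rewrite pmulr_lge0 // in c0.
  by apply: le_trans (Mc w) _; rewrite ler_piMr.
exists (((cvnorm v)^-1)%:C *: v) => //=.
by rewrite cvnormZ ?invr_ge0 ?cvnorm_ge0 // mulVf.
Qed.

Lemma Mnorm_ge0 k (M : 'M[R[i]]_k) : 0 <= Mnorm M.
Proof.
rewrite /Mnorm /opnorm; case: (pselect (has_ubound [set cvnorm (M *m x)
  | x in [set x | cvnorm x <= 1]])) => [ub|nub].
  by apply: (ub_le_sup ub); exists 0; rewrite /= ?mulmx0 cvnorm0.
(* Here the supremum would take its default value 0. *)
by rewrite sup_out // => -[].
Qed.
End Norms.

(** * Unitary conjugation and normalized traces of diagonal corners *)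

Section ApproximateIdempotent.
Variables (R : realType) (k : nat).
Implicit Types (v : 'cV[R[i]]_k) (M N U E X Y : 'M[R[i]]_k) (j : 'I_k).

Lemma cvnorm_unitary U v : U \is unitarymx -> cvnorm (U *m v) = cvnorm v.
Proof.
rewrite -trmxC_unitary => /unitarymxP; rewrite trmxCK => UU.
apply: cvnorm_gram_eq.
by rewrite trmx_mul map_mxM mulmxA -(mulmxA _ _ U) UU mulmx1.
Qed.

Lemma bounded_by_unitary U M c : U \is unitarymx ->
  bounded_by c M -> bounded_by c (U *m M *m U^t* ).
Proof.
move=> Uu Mc v; rewrite -!mulmxA cvnorm_unitary //.
by rewrite -(@cvnorm_unitary (U^t* ) v) ?trmxC_unitary.
Qed.

(** For empty [S] the factor is [0^-1 = 0], so the functional is 0 and stays linear and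
    contractive. *)
Definition corner_trace (S : {set 'I_k}) M : R[i] :=
  #|S|%:R^-1 * \sum_(j in S) M j j.

Lemma corner_traceD S M N :
  corner_trace S (M + N) = corner_trace S M + corner_trace S N.
Proof.
by rewrite /corner_trace -mulrDr -big_split; congr (_ * _);
   apply: eq_bigr => j _; rewrite mxE.
Qed.

Lemma corner_traceZ S c M : corner_trace S (c *: M) = c * corner_trace S M.
Proof.
rewrite /corner_trace mulrCA; congr (_ * _); rewrite mulr_sumr.
by apply: eq_bigr => j _; rewrite mxE.
Qed.

Lemma rnorm_average (S : {set 'I_k}) (F : 'I_k -> R[i]) c : 0 <= c ->
  (forall j, j \in S -> rnorm (F j) <= c) ->
  rnorm (#|S|%:R^-1 * \sum_(j in S) F j) <= c.
Proof.
move=> c0 Fc; have [->|S0] := eqVneq S finset.set0.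
  by rewrite cards0 invr0 mul0r rnorm0.
have Sgt0 : (0 < #|S|%:R :> R) by rewrite ltr0n card_gt0.
have -> : #|S|%:R^-1 = (#|S|%:R^-1)%:C :> R[i] by rewrite fmorphV rmorph_nat.
rewrite rnormM rnormC ?invr_ge0 ?ler0n // ler_pdivrMl //.
apply: le_trans (rnorm_sum _ _) _; apply: le_trans (ler_sum _ Fc) _.
by rewrite sumr_const mulr_natl.
Qed.

Lemma rnorm_corner_trace S M c : 0 <= c -> bounded_by c M ->
  rnorm (corner_trace S M) <= c.
Proof.
by move=> c0 Mc; apply: rnorm_average => // j _; exact: bounded_by_entry.
Qed.

(** * Almost idempotent matrices with orthogonal columns *)

Section Diagonal.
Variables (E : 'M[R[i]]_k) (delta : R).
Hypothesis delta_ge0 : 0 <= delta.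
Hypothesis gramE : is_diag_mx (E^t* *m E).
Hypothesis approx_idem : bounded_by delta (E - E *m E).

(** As [E^* E] is diagonal, these are the singular values of [E]. *)
Let s j := cvnorm (col j E).

Let gram_diag : E^t* *m E = diag_mx (\row_j (s j ^+ 2)%:C).
Proof.
apply/matrixP => i j; rewrite [RHS]mxE.
have [<-|ij] := eqVneq i j; last first.
  by have /is_diag_mxP/(_ i j ij) -> := gramE; rewrite mulr0n.
rewrite mulr1n [RHS]mxE /s cvnorm_adj !mxE; apply: eq_bigr => l _.
by rewrite !mxE.
Qed.

(* [E^* (E - E^2)] has [j]-th diagonal entry [s j ^+ 2 * (1 - E j j)]. *)
Let entry_approx1 j : s j * rnorm (E j j - 1) <= delta.
Proof.
have [->|s0] := eqVneq (s j) 0; first by rewrite mul0r.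
have sgt0 : 0 < s j by rewrite lt_def s0 cvnorm_ge0.
rewrite -(ler_pM2l sgt0) mulrA -expr2.
have -> : s j ^+ 2 * rnorm (E j j - 1) =
    rnorm (((col j E)^t* *m col j (E - E *m E)) 0 0).
  have -> : ((col j E)^t* *m col j (E - E *m E)) 0 0 =
            (E^t* *m (E - E *m E)) j j.
    by rewrite !mxE; apply: eq_bigr => l _; rewrite !mxE.
  rewrite mulmxBr mulmxA gram_diag mul_diag_mx !mxE eqxx mulr1n.
  rewrite -{1}(mulr1 (s j ^+ 2)%:C) -mulrBr rnormM rnormC ?sqr_ge0 //.
  by rewrite -(rnormN (1 - _)) opprB.
apply: le_trans (cvnorm_CauchySchwarz _ _) _.
rewrite ler_wpM2l ?cvnorm_ge0 // colE.
by apply: le_trans (approx_idem _) _; rewrite cvnorm_delta mulr1.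
Qed.

Lemma entry_near1 j : 2^-1 <= s j -> rnorm (E j j - 1) <= 2 * delta.
Proof.
move=> sj; have := entry_approx1 j; have := rnorm_ge0 (E j j - 1).
nra.
Qed.

(** If [s j < 1/2], then [E j j], an entry of column [j], is at distance more than 1/2 from 1, and
    [entry_approx1] gives the bound. A column norm is thus at least 1/2 or at most [2 * delta]. *)
Lemma small_column j : s j < 2^-1 -> s j <= 2 * delta.
Proof.
move=> sj; have := entry_approx1 j.
have Es : rnorm (E j j) <= s j.
  by have := cvnorm_coord (col j E) j; rewrite mxE.
have : 1 <= rnorm (E j j) + rnorm (E j j - 1).
  rewrite -[leLHS](rnorm1 R) -(rnormN (_ - 1)).
  by apply: le_trans (rnormD _ _); rewrite opprB addrC subrK.
have := cvnorm_ge0 (col j E); rewrite -/(s j).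
nra.
Qed.

(** Pythagoras for the orthogonal columns of [E]. *)
Lemma cvnorm_gram v : cvnorm (E *m v) ^+ 2 = \sum_j (s j * rnorm (v j 0)) ^+ 2.
Proof.
apply: realC_inj.
rewrite cvnorm_adj trmx_mul map_mxM mulmxA -(mulmxA _ _ E) gram_diag.
rewrite -mulmxA mxE rmorph_sum; apply: eq_bigr => j _ /=.
by rewrite mul_diag_mx !mxE exprMn [RHS]rmorphM /= rnormCK; ring.
Qed.

Definition large : {set 'I_k} := [set j | 2^-1 <= s j].

Lemma small_part v : (forall j, j \in large -> v j 0 = 0) ->
  cvnorm (E *m v) <= 2 * delta * cvnorm v.
Proof.
move=> v0.
rewrite -(@ler_pXn2r _ 2) ?nnegrE ?mulr_ge0 ?cvnorm_ge0 //.
rewrite cvnorm_gram exprMn cvnorm_sqr mulr_sumr ler_sum // => j _.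
rewrite -exprMn ler_pXn2r ?nnegrE ?mulr_ge0 ?rnorm_ge0 ?cvnorm_ge0 //.
have [/v0 ->|] := boolP (j \in large); first by rewrite rnorm0 !mulr0.
by rewrite inE -ltNge => /small_column sj; rewrite ler_wpM2r ?rnorm_ge0.
Qed.

(** The orthogonal projection onto the complement of the corner. *)
Definition off_large : 'M[R[i]]_k := diag_mx (\row_j (j \notin large)%:R).

Lemma off_largeE v j : (off_large *m v) j 0 = (j \notin large)%:R * v j 0.
Proof. by rewrite mul_diag_mx !mxE. Qed.

Lemma bounded_by_off_large : bounded_by 1 off_large.
Proof.
move=> v; rewrite mul1r -(@ler_pXn2r _ 2) ?nnegrE ?cvnorm_ge0 //.
rewrite !cvnorm_sqr ler_sum // => j _; rewrite off_largeE.
by case: (j \in large) => /=; rewrite ?mul1r // mul0r rnorm0 expr0n sqr_ge0.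
Qed.

Lemma bounded_by_mul_off_large : bounded_by (2 * delta) (E *m off_large).
Proof.
move=> v; rewrite -mulmxA; apply: le_trans (small_part _) _ => [j lj|].
  by rewrite off_largeE lj mul0r.
rewrite ler_wpM2l ?mulr_ge0 //.
by have := bounded_by_off_large v; rewrite mul1r.
Qed.

(** Each averaged entry is within [2 * delta] of 1; the set must be nonempty because the average
    over the empty set is 0. *)
Lemma corner_trace_near1 : large != finset.set0 ->
  rnorm (corner_trace large E - 1) <= 2 * delta.
Proof.
move=> L0; have -> : corner_trace large E - 1 =
    #|large|%:R^-1 * \sum_(j in large) (E j j - 1).
  by rewrite sumrB sumr_const mulrBr mulVf // pnatr_eq0 cards_eq0.
apply: rnorm_average; first by rewrite mulr_ge0.
by move=> j; rewrite inE; exact: entry_near1.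
Qed.

(** Serves to rule out an empty corner once the norm of [E] exceeds [2 * delta]. *)
Lemma bounded_by_no_large : large = finset.set0 -> bounded_by (2 * delta) E.
Proof. by move=> L0 v; apply: small_part => j; rewrite L0 inE. Qed.

Lemma mxE_off_large X Y j :
  (X *m off_large *m Y) j j = \sum_(l | l \notin large) X j l * Y l j.
Proof.
rewrite -mulmxA mxE [RHS]big_mkcond; apply: eq_bigr => l _.
by rewrite mul_diag_mx !mxE; case: (l \in large); rewrite ?mul1r // mul0r mulr0.
Qed.

(* The part of the trace that factors through the corner is symmetric. *)
Lemma corner_trace_comm X Y :
  corner_trace large (X *m Y) - corner_trace large (Y *m X) =
  corner_trace large (X *m off_large *m Y) -
  corner_trace large (Y *m off_large *m X).
Proof.
have split_in M N : \sum_(j in large) (M *m N) j j =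
    \sum_(j in large) \sum_(l in large) M j l * N l j +
    \sum_(j in large) (M *m off_large *m N) j j.
  rewrite -big_split; apply: eq_bigr => j _.
  by rewrite mxE_off_large mxE (bigID (mem large)).
rewrite /corner_trace -!mulrBr; congr (_ * _).
rewrite (split_in X Y) (split_in Y X).
have -> : \sum_(j in large) \sum_(l in large) Y j l * X l j =
    \sum_(j in large) \sum_(l in large) X j l * Y l j.
  rewrite exchange_big; apply: eq_bigr => j _; apply: eq_bigr => l _.
  exact: mulrC.
by rewrite opprD addrACA subrr add0r.
Qed.

(** The product [E *m off_large] is small, so [X] is replaced by [X *m E] at the cost of [x]. *)
Lemma rnorm_corner_trace_off X Y a b x : 0 <= a -> 0 <= b -> 0 <= x ->
  bounded_by a X -> bounded_by b Y -> bounded_by x (X - X *m E) ->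
  rnorm (corner_trace large (X *m off_large *m Y)) <= (x + 2 * delta * a) * b.
Proof.
move=> a0 b0 x0 Xa Yb Xx.
have -> : X *m off_large *m Y =
    (X - X *m E) *m off_large *m Y + X *m (E *m off_large) *m Y.
  by rewrite !mulmxBl !mulmxA subrK.
rewrite corner_traceD; apply: le_trans (rnormD _ _) _.
(* The factor 1 is the norm bound of [off_large] in the first summand. *)
rewrite mulrDl -[x](mulr1) -(mulrC a).
have ? : 0 <= a * (2 * delta) by rewrite !mulr_ge0.
apply: lerD; apply: rnorm_corner_trace; rewrite ?mulr_ge0 //.
  apply: bounded_by_mul => //; first by rewrite mulr1.
  exact: bounded_by_mul bounded_by_off_large.
by apply: bounded_by_mul => //; apply: bounded_by_mul bounded_by_mul_off_large.
Qed.

End Diagonal.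
End ApproximateIdempotent.

(** * Approximate traces for an arbitrary matrix *)

Lemma Mnorm_le (R : realType) k (M : 'M[R[i]]_k) c : 0 <= c ->
  bounded_by c M -> Mnorm M <= c.
Proof.
move=> c0 Mc; apply: ge_sup.
  by exists (cvnorm (M *m 0)); exists 0 => //=; rewrite cvnorm0.
by move=> _ [v /= v1 <-]; apply: le_trans (Mc v) _; rewrite ler_piMr.
Qed.

(** The spectral theorem for the normal matrix [E^* E]: conjugating [E] by a unitary conjugates
    [E^* E] by the same unitary. *)
Lemma gram_diagonalizable (C : numClosedFieldType) k (E : 'M[C]_k) :
  exists2 U : 'M[C]_k, U \is unitarymx &
    is_diag_mx ((U *m E *m U^t* )^t* *m (U *m E *m U^t* )).
Proof.
have Enormal : E^t* *m E \is normalmx.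
  by apply/normalmxP; rewrite trmx_mul map_mxM trmxCK.
exists (spectralmx (E^t* *m E)); first exact: spectral_unitarymx.
set U := spectralmx _; have Uu : U \is unitarymx by exact: spectral_unitarymx.
have UtU : U^t* *m U = 1%:M.
  by move: Uu; rewrite -trmxC_unitary => /unitarymxP; rewrite trmxCK.
rewrite !trmx_mul !map_mxM trmxCK -!mulmxA [X in U *m (_ *m X)]mulmxA UtU mul1mx.
have := orthomx_spectralP Enormal; rewrite -/U invmx_unitary // => Ediag.
rewrite [X in U *m X]mulmxA Ediag !mulmxA (unitarymxP Uu) mul1mx -mulmxA.
by rewrite (unitarymxP Uu) mulmx1 diag_mx_is_diag.
Qed.

(** A basis-free list of what the limit argument uses. The premise of the third clause excludes the
    empty corner. The bound in the fourth is small when [E] is almost idempotent and almost a right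
    unit for [X] and [Y], as long as these stay bounded. *)
Definition approximate_trace (R : realType) k (E : 'M[R[i]]_k)
    (t : 'M[R[i]]_k -> R[i]) : Prop :=
  [/\ forall c M N, t (c *: M + N) = c * t M + t N,
      forall M, rnorm (t M) <= Mnorm M,
      2 * Mnorm (E - E *m E) < Mnorm E ->
        rnorm (t E - 1) <= 2 * Mnorm (E - E *m E)
    & forall X Y, rnorm (t (X *m Y) - t (Y *m X)) <=
        (Mnorm (X - X *m E) + 2 * Mnorm (E - E *m E) * Mnorm X) * Mnorm Y +
        (Mnorm (Y - Y *m E) + 2 * Mnorm (E - E *m E) * Mnorm Y) * Mnorm X].

(** Conjugation [ad] by the unitary of [gram_diagonalizable] is multiplicative and preserves bounds,
    so the estimates for orthogonal columns apply to [ad E] and pull back. *)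
Lemma approximate_trace_exists (R : realType) k (E : 'M[R[i]]_k) :
  exists t, approximate_trace E t.
Proof.
have [U Uu Udiag] := gram_diagonalizable E.
have UtU : U^t* *m U = 1%:M.
  by move: Uu; rewrite -trmxC_unitary => /unitarymxP; rewrite trmxCK.
pose ad M := U *m M *m U^t*.
have adD M N : ad (M + N) = ad M + ad N by rewrite /ad mulmxDr mulmxDl.
have adB M N : ad (M - N) = ad M - ad N by rewrite /ad mulmxBr mulmxBl.
have adM M N : ad (M *m N) = ad M *m ad N.
  by rewrite /ad -!mulmxA [X in _ = _ *m (_ *m X)]mulmxA UtU mul1mx.
have ad_bounded M : bounded_by (Mnorm M) (ad M).
  exact: bounded_by_unitary (bounded_by_Mnorm M).
have idem : bounded_by (Mnorm (E - E *m E)) (ad E - ad E *m ad E).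
  by rewrite -adM -adB; exact: ad_bounded.
have d0 := Mnorm_ge0 (E - E *m E).
exists (fun M => corner_trace (large (ad E)) (ad M)); split.
- move=> c M N; rewrite adD corner_traceD; congr (_ + _).
  by rewrite /ad -scalemxAr -scalemxAl corner_traceZ.
- by move=> M; exact: rnorm_corner_trace (Mnorm_ge0 M) (ad_bounded M).
- move=> dE; apply: (corner_trace_near1 d0 Udiag idem).
  (* Without large columns [ad E], hence also [E] after undoing the conjugation, has norm at most
     [2 * Mnorm (E - E *m E)], against the premise. *)
  apply: contraTneq dE => L0; rewrite -leNgt; apply: Mnorm_le.
    by rewrite mulr_ge0.
  have UtEU : U^t* *m ad E *m U^t*^t* = E.
    by rewrite trmxCK /ad -!mulmxA UtU mulmx1 mulmxA UtU mul1mx.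
  have Utu : U^t* \is unitarymx by rewrite trmxC_unitary.
  have := bounded_by_unitary Utu (bounded_by_no_large d0 Udiag idem L0).
  by rewrite UtEU.
- have off X Y : rnorm (corner_trace (large (ad E))
      (ad X *m off_large (ad E) *m ad Y)) <=
      (Mnorm (X - X *m E) + 2 * Mnorm (E - E *m E) * Mnorm X) * Mnorm Y.
    apply: (rnorm_corner_trace_off d0 Udiag idem (Mnorm_ge0 X) (Mnorm_ge0 Y)
             (Mnorm_ge0 _) (ad_bounded X) (ad_bounded Y)).
    by rewrite -adM -adB; exact: ad_bounded.
  (* Only the two products passing through the complement of the corner remain. *)
  move=> X Y; rewrite !adM corner_trace_comm.
  by apply: le_trans (rnormD _ _) _; rewrite rnormN lerD.
Qed.

(** * Limits of bounded functions along an ultrafilter *)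

Lemma rnorm_le_ReIm (R : realType) (z : R[i]) :
  rnorm z <= `|complex.Re z| + `|complex.Im z|.
Proof.
rewrite [z in leLHS]complexE; apply: le_trans (rnormD _ _) _.
have rnormR (x : R) : rnorm x%:C = `|x|.
  by rewrite /rnorm normc_def /= expr0n addr0 sqrtr_sqr.
by rewrite rnormM !rnormR /rnorm normc_def /= expr0n add0r expr1n sqrtr1 mul1r.
Qed.

Lemma abs_Re_le (R : realType) (z : R[i]) : `|complex.Re z| <= rnorm z.
Proof. by have := normc_ge_Re z; rewrite -rnormE lecR. Qed.

Lemma abs_Im_le (R : realType) (z : R[i]) : `|complex.Im z| <= rnorm z.
Proof.
rewrite /rnorm normc_def /= -sqrtr_sqr ler_wsqrtr // lerDr sqr_ge0 //.
Qed.

(** Compactness of [[-c, c]] gives a cluster point, and a cluster point of an ultrafilter is a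
    limit. *)
Lemma ultra_cvg_bounded (R : realType) (I : Type) (U : set_system I)
    (g : I -> R) c : UltraFilter U -> (\forall i \near U, `|g i| <= c) ->
  exists l : R, g @ U --> l.
Proof.
move=> UU gc; have UP : ProperFilter U := ultra_proper.
have gUP : ProperFilter (g @ U) by exact: fmap_proper_filter.
have [|l [_ gl]] := @segment_compact R (- c) c (g @ U) gUP.
  by apply: filterS gc => i; rewrite /= in_itv /= ler_norml.
exists l => B lB; have [//|UB] := in_ultra_setVsetC (g @^-1` B) UU.
have [|x [nBx Bx]] := gl (~` B) B _ lB; first by [].
by case: nBx.
Qed.

(** Real and imaginary parts converge separately. Convergence is stated through [rnorm], so that all
    later limits are limits of real functions. *)
Lemma ultra_limit (R : realType) (I : Type) (U : set_system I)
    (f : I -> R[i]) c : UltraFilter U -> (\forall i \near U, rnorm (f i) <= c) ->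
  exists z : R[i], (fun i => rnorm (f i - z)) @ U --> (0 : R).
Proof.
move=> UU fc; have UP : ProperFilter U := ultra_proper.
have [|x fx] := @ultra_cvg_bounded R I U (fun i => complex.Re (f i)) c UU.
  by apply: filterS fc => i; apply: le_trans (abs_Re_le _).
have [|y fy] := @ultra_cvg_bounded R I U (fun i => complex.Im (f i)) c UU.
  by apply: filterS fc => i; apply: le_trans (abs_Im_le _).
exists (x +i* y).
have dist0 (g : I -> R) l : g @ U --> l -> (fun i => `|g i - l|) @ U --> (0 : R).
  move=> gl; rewrite -[X in _ --> X](normr0 R); apply: cvg_norm.
  by rewrite -[X in _ --> X](subrr l); apply: cvgB gl _; exact: cvg_cst.
have fxy : (fun i => `|complex.Re (f i) - x| + `|complex.Im (f i) - y|) @ U -->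
    (0 : R).
  by rewrite -[X in _ --> X](addr0 0); apply: cvgD; exact: dist0.
apply: (squeeze_cvgr _ (cvg_cst 0) fxy).
apply: nearW => i; rewrite rnorm_ge0 /=.
by apply: le_trans (rnorm_le_ReIm _) _; case: (f i).
Qed.

(** Reflexivity makes each tail nonempty, and the tail of an upper bound of two indices lies in both
    of their tails. *)
Lemma tails_proper (I : Type) (le : I -> I -> Prop) :
  directed le -> ProperFilter (tails le).
Proof.
move=> [[i0] lexx let_ ub]; apply: filter_from_proper => [|i _]; last first.
  by exists i; exact: lexx.
apply: filter_from_filter; first by exists i0.
move=> i j _ _; have [l [il jl]] := ub i j.
by exists l => // m lm; split; [exact: let_ il lm | exact: let_ jl lm].
Qed.

(** * The limit functional and its properties *)

Section UltraTrace.
Variables (R : realType) (H : normedModType R[i]) (A : set (H -> H)).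
Variables (e : H -> H) (I : Type) (U : set_system I) (k : I -> nat).
Variable phi : forall i, (H -> H) -> 'M[R[i]]_(k i).
Hypothesis UU : UltraFilter U.
Hypothesis mulA : forall a b, A a -> A b -> A (a \o b).
Hypothesis linA : forall (c : R[i]) a b, A a -> A b -> A (c *: a + b).
Hypothesis unitA : opalg_unit A e.
Hypothesis phi_linear : forall i, linear_on A (phi i).
Hypothesis phi_norm : forall a, A a ->
  (fun i => Mnorm (phi i a)) @ U --> opnorm (@rnorm R H) a.
Hypothesis phi_mul : forall a b, A a -> A b ->
  (fun i => Mnorm (phi i (a \o b) - phi i a *m phi i b)) @ U --> (0 : R).

Let UP : ProperFilter U := ultra_proper.

Let cvg_ge_near (x l : R) (g : I -> R) :
  (\forall i \near U, x <= g i) -> g @ U --> l -> x <= l.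
Proof. by move=> xg gl; apply: (cvgr_to_ge gl). Qed.

(** Each property of [tau] comes from a bound by a real function converging along [U]; [eq_of_bound]
    turns a bound tending to 0 into an equality. *)
Lemma tracial_state_of_ultrafilter : exists tau, tracial_state A e tau.
Proof.
have Ae := unit_in unitA.
(* Asymptotic multiplicativity at [e \o e = e] makes [phi i e] almost idempotent; at [a \o e = a] it
   makes [phi i e] almost a right unit for [phi i a]. *)
pose d i := Mnorm (phi i e - phi i e *m phi i e).
have d0 : d @ U --> (0 : R).
  by have := phi_mul Ae Ae; rewrite (unit_mull unitA Ae).
have unit_right a : A a ->
    (fun i => Mnorm (phi i a - phi i a *m phi i e)) @ U --> (0 : R).
  by move=> Aa; have := phi_mul Aa Ae; rewrite (unit_mulr unitA Aa).
have [t tP] : exists t : forall i, 'M[R[i]]_(k i) -> R[i],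
    forall i, approximate_trace (phi i e) (t i).
  exists (fun i => sval (cid (approximate_trace_exists (phi i e)))) => i.
  exact: svalP.
have tB i M N : t i (M - N) = t i M - t i N.
  by have [tl _ _ _] := tP i; rewrite -scaleN1r addrC tl mulN1r addrC.
have tle i M : rnorm (t i M) <= Mnorm M by have [_ + _ _] := tP i; exact.
(* The premise [A a] stands under the existential, so that choice yields a function defined
   everywhere, with no condition outside [A]. *)
have lim_ex a : exists z : R[i], A a ->
    (fun i => rnorm (t i (phi i a) - z)) @ U --> (0 : R).
  have [Aa|nAa] := pselect (A a); last by exists 0.
  (* [Mnorm (phi i a)] converges to the norm of [a], so it is eventually at most that norm plus
     1. *)
  have [|z tz] := @ultra_limit R I U (fun i => t i (phi i a))
      (opnorm (@rnorm R H) a + 1) UU; last by exists z.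
  have norm_lt : opnorm (@rnorm R H) a < opnorm (@rnorm R H) a + 1.
    by rewrite ltrDl.
  apply: filterS (cvgr_le _ (phi_norm Aa) _ norm_lt) => i.
  exact: le_trans (tle i _).
have [tau tauP] := choice lim_ex.
have eq_of_bound (z w : R[i]) (g : I -> R) :
    (\forall i \near U, rnorm (z - w) <= g i) -> g @ U --> (0 : R) -> z = w.
  move=> zg g0; apply/eqP; rewrite -subr_eq0 -normr_eq0 -rnormE.
  by rewrite (@le_anti _ _ (rnorm (z - w)) 0) // rnorm_ge0 (cvg_ge_near zg g0).
have cvg0D (g h : I -> R) : g @ U --> (0 : R) -> h @ U --> (0 : R) ->
    (fun i => g i + h i) @ U --> (0 : R).
  by move=> g0 h0; rewrite -[X in _ --> X](addr0 0); exact: cvgD.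
have cvg0M (g h : I -> R) (l : R) : g @ U --> (0 : R) -> h @ U --> l ->
    (fun i => g i * h i) @ U --> (0 : R).
  by move=> g0 hl; rewrite -[X in _ --> X](mul0r l); exact: cvgM.
have cvg2d : (fun i => 2 * d i) @ U --> (0 : R).
  by rewrite -[X in _ --> X](mulr0 2); apply: cvgM d0; exact: cvg_cst.
have tau_lin : linear_on A (tau : (H -> H) -> R[i]^o).
  move=> c a b Aa Ab.
  apply: (eq_of_bound _ _ (fun i =>
     rnorm (t i (phi i (c *: a + b)) - tau (c *: a + b)) +
     (rnorm (t i (phi i a) - tau a) * rnorm c +
      rnorm (t i (phi i b) - tau b)))).
    apply: nearW => i; have [tl _ _ _] := tP i.
    rewrite phi_linear // tl [X in _ + (X + _)]mulrC -rnormM.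
    have -> : tau (c *: a + b) - (c *: (tau a : R[i]^o) + tau b) =
        - (c * t i (phi i a) + t i (phi i b) - tau (c *: a + b)) +
        (c * (t i (phi i a) - tau a) + (t i (phi i b) - tau b)).
      by rewrite /GRing.scale /=; ring.
    apply: le_trans (rnormD _ _) _; rewrite rnormN lerD2l.
    exact: rnormD.
  apply: (cvg0D); first by apply: tauP; exact: linA.
  apply: (cvg0D); last exact: tauP.
  apply: (cvg0M); first exact: tauP.
  exact: cvg_cst.
have tau_le a : A a -> rnorm (tau a) <= opnorm (@rnorm R H) a.
  move=> Aa; apply: (@cvg_ge_near _ _ (fun i =>
      rnorm (t i (phi i a) - tau a) + Mnorm (phi i a))).
    apply: nearW => i.
    rewrite -[tau a in leLHS](subKr (t i (phi i a))) addrC.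
    apply: le_trans (rnormD _ _) _; rewrite rnormN.
    by apply: lerD (lexx _) (tle _ _).
  by rewrite -[X in _ --> X]add0r; apply: cvgD; [exact: tauP|exact: phi_norm].
have tau_e : tau e = 1.
  apply: (eq_of_bound _ _ (fun i => rnorm (t i (phi i e) - tau e) + 2 * d i)).
    (* The norms tend to 1 and the defects to 0, so 1/2 eventually separates them and the third
       clause of [approximate_trace] applies. *)
    have big_e : \forall i \near U, 2^-1 < Mnorm (phi i e).
      apply: (cvgr_gt _ (phi_norm Ae)).
      by rewrite (unit_norm unitA) invf_lt1 ?ltr1n.
    have small_d : \forall i \near U, 2 * d i < 2^-1.
      by apply: (cvgr_lt _ cvg2d); rewrite invr_gt0.
    near=> i; have [_ _ te _] := tP i.
    have -> : tau e - 1 =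
        - (t i (phi i e) - tau e) + (t i (phi i e) - 1) by ring.
    apply: le_trans (rnormD _ _) _; rewrite rnormN lerD2l te //.
    by apply: lt_trans (_ : 2^-1 < _); near: i.
  by apply: (cvg0D) => //; exact: tauP.
exists tau; split; last first.
  move=> a b Aa Ab.
  pose m x i := Mnorm (phi i x).
  pose r x i := Mnorm (phi i x - phi i x *m phi i e).
  pose q x y i := Mnorm (phi i (x \o y) - phi i x *m phi i y).
  (* Three kinds of error: passing to the limit at the two products, the two multiplicativity
     defects, and the commutator bound of [approximate_trace]. *)
  apply: (eq_of_bound _ _ (fun i =>
     rnorm (t i (phi i (a \o b)) - tau (a \o b)) +
     rnorm (t i (phi i (b \o a)) - tau (b \o a)) + q a b i + q b a i +
     ((r a i + 2 * d i * m a i) * m b i + (r b i + 2 * d i * m b i) * m a i))).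
    apply: nearW => i; have [_ _ _ tc] := tP i.
    have -> : tau (a \o b) - tau (b \o a) =
      - (t i (phi i (a \o b)) - tau (a \o b)) +
      (t i (phi i (b \o a)) - tau (b \o a)) +
      t i (phi i (a \o b) - phi i a *m phi i b) +
      - t i (phi i (b \o a) - phi i b *m phi i a) +
      (t i (phi i a *m phi i b) - t i (phi i b *m phi i a)).
      by rewrite !tB; ring.
    apply: le_trans (rnormD _ _) _; apply: lerD (tc _ _).
    apply: le_trans (rnormD _ _) _; apply: lerD; last by rewrite rnormN tle.
    apply: le_trans (rnormD _ _) _; apply: lerD (tle _ _).
    by apply: le_trans (rnormD _ _) _; rewrite rnormN.
  apply: (cvg0D).
    apply: (cvg0D); last exact: phi_mul.
    apply: (cvg0D); last exact: phi_mul.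
    by apply: (cvg0D); apply: tauP; exact: mulA.
  apply: (cvg0D); (apply: (cvg0M); [apply: (cvg0D); [exact: unit_right|]|]);
    by [apply: (cvg0M _ _ _ cvg2d); exact: phi_norm | exact: phi_norm].
(* The supremum is at most 1 by [tau_le], and it is attained at [e], which has norm 1. *)
split => //; apply/le_anti/andP; split.
  apply: ge_sup.
    by exists (rnorm (tau e)); exists e => //; split => //; rewrite (unit_norm unitA).
  by move=> _ [a /= [Aa a1] <-]; exact: le_trans (tau_le a Aa) a1.
rewrite -[leLHS](rnorm1 R) -tau_e; apply: ub_le_sup.
  by exists 1 => _ [a /= [Aa a1] <-]; exact: le_trans (tau_le a Aa) a1.
by exists e => //; split => //; rewrite (unit_norm unitA).
Unshelve. all: by end_near.
Qed.

End UltraTrace.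

Theorem proposition2p9 (R : realType) (H : completeNormedModType R[i])
    (dot : {dot H for (@Num.conj R[i])}) (A : set (H -> H)) (e : H -> H) :
  hilbert_dot dot -> operator_algebra A -> opalg_unit A e ->
  quasitriangular A ->
  exists tau : (H -> H) -> R[i], tracial_state A e tau.
Proof.
move=> _ Aalg Aunit [I [le [k [phi [ledir _ phi_cc phi_norm phi_mul]]]]].
(* An ultrafilter containing the tails keeps the limits of the net and makes bounded functions
   converge. *)
have [U [UU tailsU]] := ultraFilterLemma (tails_proper ledir).
apply: (@tracial_state_of_ultrafilter R H A e I U k phi) => //.
- exact: opalg_mul Aalg.
- exact: opalg_lin Aalg.
- by move=> i; have [] := phi_cc i.
- by move=> a Aa; apply: cvg_trans (phi_norm a Aa) => B /=; exact: tailsU.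
- by move=> a b Aa Ab; apply: cvg_trans (phi_mul a b Aa Ab) => B /=; exact: tailsU.
Qed.
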